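(* Let $\mathcal{H}\subset\mathbb{M}_{M,N}$ be a linear subspace, let $F\in\mathcal{H}$, $\tau>0$ and $1<q<\infty$. Let $W^{\circ}$ be the fixed point of $\mathfrak{B}_{F,\tau,q}$ to which the Picard iteration $W^{n+1}=\mathfrak{B}_{F,\tau,q}(W^n)$ converges, and let $$A^{\circ}=\frac{1}{q-1}\left(qF-\mathcal{P}_{\mathcal{H}}(W^{\circ})\right).$$ Then $A^{\circ}$ solves $$\operatorname*{arg\,min}_{A}\ \mathcal{R}_{\tau}(A)+\|A-W^{\circ}\|^2$$ (minimization over all $A\in\mathbb{M}_{M,N}$, without the condition $A\in\mathcal{H}$). Moreover, if $W^{\circ}=U\,\mathrm{diag}(\sigma_j(W^{\circ}))V^*$, then $A^{\circ}=U\,\mathrm{diag}(\sigma_j(A^{\circ}))V^*$, where $$\begin{cases}\sigma_j(A^{\circ})=\sigma_j(W^{\circ}), & \text{if }\sigma_j(W^{\circ})>\tau,\\ 0\le\sigma_j(A^{\circ})\le\sigma_j(W^{\circ}), & \text{if }\sigma_j(W^{\circ})=\tau,\\ \sigma_j(A^{\circ})=0, & \text{if }\sigma_j(W^{\circ})<\tau.\end{cases}$$ In particular, if $W^{\circ}$ has no singular values equal to $\tau$, then $A^{\circ}$ is the solution to the non-convex problem $$\operatorname*{arg\,min}_{A\in\mathcal{H}}\ \tau^2\,\mathrm{rank}(A)+q\|A-F\|^2 .$$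
   Context: $\mathbb{M}_{M,N}$ is the Euclidean space of $M\times N$ matrices with the Frobenius norm $\|\cdot\|$; $\sigma_j(A)$ denotes the singular values of $A$, and $W^{\circ}=U\,\mathrm{diag}(\sigma_j(W^{\circ}))V^*$ denotes a singular value decomposition of $W^{\circ}$. For $\tau>0$, $$\mathcal{R}_{\tau}(A)=\sum_j\left(\tau^2-\big(\max(\tau-\sigma_j(A),0)\big)^2\right).$$ $\mathcal{P}_{\mathcal{H}}$ and $\mathcal{P}_{\mathcal{H}^\perp}$ are the orthogonal projections onto $\mathcal{H}$ and its orthogonal complement. Singular value functional calculus: for a real-valued $f$ on $[0,\infty)$ with $f(0)=0$ and a matrix $A$ with singular value decomposition $A=U\,\mathrm{diag}(\{\sigma_j(A)\})V^*$, $\mathfrak{S}_f(A)=U\,\mathrm{diag}(\{f(\sigma_j(A))\})V^*$. Set $s_{\tau,q}(\sigma)=\max\left(\min(\sigma,\tau),\frac{\sigma}{q}\right)$ and $$\mathfrak{B}_{F,\tau,q}(W)=\mathfrak{S}_{s_{\tau,q}}\big(qF+\mathcal{P}_{\mathcal{H}^\perp}(W)\big),\qquad W\in\mathbb{M}_{M,N}.$$ It is known that the Picard iteration converges to a fixed point $W^{\circ}$ from any starting point, that $\mathcal{P}_{\mathcal{H}}(W^{\circ})$ is unique, and that $A^{\circ}$ is the unique solution of $\operatorname*{arg\,min}_{A\in\mathcal{H}}\mathcal{R}_{\tau}(A)+q\|A-F\|^2$.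
   Formalization: The formula A°=U diag(σ_j(A°))V* is proved for some SVD of W°, and for every SVD only if the σ_j(A°) with σ_j(W°)=τ are all equal; for every SVD without this it is false (H everything, F=diag(τ/q,τ), W°=τI). *)

(* Defs.v *)
From mathcomp Require Import all_boot all_order all_algebra.
From mathcomp Require Import complex.
From mathcomp Require Import all_classical all_reals all_analysis.

Set Implicit Arguments.
Unset Strict Implicit.
Unset Printing Implicit Defensive.

Import Order.TTheory GRing.Theory Num.Theory.
Import numFieldNormedType.Exports.

Local Open Scope classical_set_scope.
Local Open Scope ring_scope.

(* Matrices may have real or complex entries, so everything below is
   parameterized by the choice of the scalar field. *)
Variant scalars := RealScalars | ComplexScalars.

Definition scalar_field (R : realType) (k : scalars) : numFieldType :=
  match k with RealScalars => R | ComplexScalars => R[i] end.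

Definition of_real (R : realType) (k : scalars) : R -> scalar_field R k :=
  match k return R -> scalar_field R k with
  | RealScalars => id
  | ComplexScalars => real_complex R
  end.
Arguments of_real {R k} x.

Definition re_part (R : realType) (k : scalars) : scalar_field R k -> R :=
  match k return scalar_field R k -> R with
  | RealScalars => id
  | ComplexScalars => @complex.Re R
  end.
Arguments re_part {R k} x.

Definition conj_scalar (R : realType) (k : scalars) :
    scalar_field R k -> scalar_field R k :=
  match k return scalar_field R k -> scalar_field R k with
  | RealScalars => id
  | ComplexScalars => @conjc R
  end.
Arguments conj_scalar {R k} x.

Section Matrices.
Context {R : realType} {k : scalars}.
Local Notation K := (scalar_field R k).

Definition adjoint m n (A : 'M[K]_(m, n)) : 'M[K]_(n, m) :=
  (map_mx conj_scalar A)^T.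

Definition inner m n (A B : 'M[K]_(m, n)) : K := \tr (A *m adjoint B).

Definition frobenius m n (A : 'M[K]_(m, n)) : R :=
  Num.sqrt (re_part (inner A A)).

Definition orthogonal_complement m n (E : set 'M[K]_(m, n)) :
    set 'M[K]_(m, n) :=
  [set A | forall B, E B -> inner A B = 0].

(* The point of E at which the error is orthogonal to E; it exists and is
   unique when E is a linear subspace. *)
Definition orth_proj m n (E : set 'M[K]_(m, n)) (A : 'M[K]_(m, n)) :
    'M[K]_(m, n) :=
  xget 0 [set B | E B /\ orthogonal_complement E (A - B)].

Definition real_diag n (s : 'rV[R]_n) : 'M[K]_n := diag_mx (map_mx of_real s).

(* Reduced singular value decomposition A = U diag(s) V^*: U and V have
   min(m, n) orthonormal columns and s lists the min(m, n) singular values, with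
   multiplicity and zeros included, in nonincreasing order. *)
Definition is_svd m n (A : 'M[K]_(m, n)) (U : 'M[K]_(m, minn m n))
    (s : 'rV[R]_(minn m n)) (V : 'M[K]_(n, minn m n)) : Prop :=
  [/\ adjoint U *m U = 1%:M,
      adjoint V *m V = 1%:M,
      (forall j, 0 <= s 0 j),
      (forall i j : 'I_(minn m n), (i <= j)%N -> s 0 j <= s 0 i)
    & A = U *m real_diag s *m adjoint V].

(* Some singular value decomposition of A. The definitions of sing_val and
   sv_calculus below do not depend on which one, the latter because it is only
   used with f 0 = 0. *)
Definition svd m n (A : 'M[K]_(m, n)) :
    'M[K]_(m, minn m n) * 'rV[R]_(minn m n) * 'M[K]_(n, minn m n) :=
  xget (0, 0, 0) [set D | is_svd A D.1.1 D.1.2 D.2].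

Definition sing_val m n (A : 'M[K]_(m, n)) : 'rV[R]_(minn m n) :=
  (svd A).1.2.

Definition sv_calculus (f : R -> R) m n (A : 'M[K]_(m, n)) : 'M[K]_(m, n) :=
  (svd A).1.1 *m real_diag (map_mx f (svd A).1.2) *m adjoint (svd A).2.

Definition R_tau (tau : R) m n (A : 'M[K]_(m, n)) : R :=
  \sum_j (tau ^+ 2 - Num.max (tau - sing_val A 0 j) 0 ^+ 2).

Definition s_tau_q (tau q sigma : R) : R :=
  Num.max (Num.min sigma tau) (sigma / q).

Definition B_op m n (H : {vspace 'M[K]_(m, n)}) (F : 'M[K]_(m, n)) (tau q : R)
    (W : 'M[K]_(m, n)) : 'M[K]_(m, n) :=
  sv_calculus (s_tau_q tau q)
    (of_real q *: F + orth_proj (orthogonal_complement [set` H]) W).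

End Matrices.

Definition argmin (R : realType) (T : Type) (D : set T) (f : T -> R) : set T :=
  [set x | D x /\ forall y, D y -> f x <= f y].

(* Main.v *)
Require Import Defs.
From mathcomp Require Import all_boot all_order all_algebra.
From mathcomp Require Import complex.
From mathcomp Require Import all_classical all_reals all_analysis.
From HB Require Import structures.
From mathcomp Require Import perm spectral sesquilinear ring lra.

Set Implicit Arguments.
Unset Strict Implicit.
Unset Printing Implicit Defensive.

Import Order.TTheory GRing.Theory Num.Theory.
Import numFieldNormedType.Exports.

Local Open Scope classical_set_scope.
Local Open Scope ring_scope.

(** Write Z = q F + P_{H^perp}(Wo), with singular value decomposition
    Z = U diag(z) V^*. The fixed point equation says Wo = U diag(s(z)) V^* with
    s = s_{tau,q}, and since Z - Wo = q F - P_H(Wo) = (q - 1) Ao, also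
    Ao = U diag(a(z)) V^* with a(z) = (z - s(z)) / (q - 1). On z >= 0 both s and a are
    nonnegative and nondecreasing, so these are again sorted singular value
    decompositions, with common U and V: the relation between the singular
    values of Ao and those of Wo is a relation between the scalar functions a
    and s, read off in three ranges of z ([s_tau_q_cases]).

    Minimality of Ao for R_tau(A) + |A - Wo|^2 is Fenchel duality. Put
    g(x) = tau^2 - max(tau - x, 0)^2 + x^2, so that R_tau(A) + |A|^2 is the sum
    of g over the singular values of A, and h(y) = max(y, tau)^2 - tau^2. Both
    are nonnegative, 2 x y <= g(x) + h(y) for x, y >= 0, and equality holds at
    (a(z), s(z)). The matrix version [trace_fenchel],
    2 Re <A, W> <= sum g(sigma_i(A)) + sum h(sigma_j(W)), then bounds the
    objective from below by a quantity that Ao attains.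

    On H one has q |A - F|^2 = |A - Wo|^2 + (q - 1) |A - Ao|^2 + C with C
    independent of A ([objective_transfer]): the cross terms agree because
    (q - 1) Ao = q F - P_H(Wo) and Wo - P_H(Wo) is orthogonal to H. Hence Ao
    minimizes R_tau(A) + q |A - F|^2 on H, and any competitor loses at least
    (q - 1) |A - Ao|^2. Finally R_tau <= tau^2 rank, with equality at Ao when
    the singular values of Ao avoid the open interval (0, tau), which is the
    case as soon as tau is not a singular value of Wo. So Ao also minimizes the
    rank-penalized objective, with the same gap, hence uniquely
    ([objective_gap]).

    The matrix facts behind this are proved simultaneously for real and complex
    scalars: existence of singular value decompositions, by splitting off
    singular pairs one at a time ([svd_exists]); independence of the functional
    calculus from the decomposition ([svd_map_unique]), from which uniqueness of
    the singular values follows; and existence of orthogonal projections, from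
    the invertibility of a Gram matrix. *)

(** * Scalars *)

Section Scalars.
Variables (R : realType) (k : scalars).
Local Notation K := (scalar_field R k).
Implicit Types (a : R) (z w : K).

Lemma conj_scalar_is_zmod_morphism : zmod_morphism (@conj_scalar R k).
Proof. by case: k => x y; [|exact: rmorphB]. Qed.

Lemma conj_scalar_is_monoid_morphism : monoid_morphism (@conj_scalar R k).
Proof. by case: k; split=> //; [exact: rmorph1 | exact: rmorphM]. Qed.

HB.instance Definition _ :=
  GRing.isZmodMorphism.Build K K conj_scalar conj_scalar_is_zmod_morphism.
HB.instance Definition _ :=
  GRing.isMonoidMorphism.Build K K conj_scalar conj_scalar_is_monoid_morphism.

Lemma of_real_is_zmod_morphism : zmod_morphism (@of_real R k).
Proof. by case: k => x y; [|exact: rmorphB]. Qed.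

Lemma of_real_is_monoid_morphism : monoid_morphism (@of_real R k).
Proof. by case: k; split=> //; exact: rmorphM. Qed.

HB.instance Definition _ :=
  GRing.isZmodMorphism.Build R K of_real of_real_is_zmod_morphism.
HB.instance Definition _ :=
  GRing.isMonoidMorphism.Build R K of_real of_real_is_monoid_morphism.

Lemma re_part_is_zmod_morphism : zmod_morphism (@re_part R k).
Proof. by case: k => x y //=; case: x; case: y. Qed.

HB.instance Definition _ :=
  GRing.isZmodMorphism.Build K R re_part re_part_is_zmod_morphism.

Lemma conj_scalarK : involutive (@conj_scalar R k).
Proof. by case: k => x //=; rewrite conjcK. Qed.

Lemma conj_of_real a : conj_scalar (of_real a) = of_real a :> K.
Proof. by case: k; [|exact: conjc_real]. Qed.

Lemma re_part_of_real a : re_part (of_real a : K) = a.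
Proof. by case: k. Qed.

Lemma re_part_conj z : re_part (conj_scalar z) = re_part z.
Proof. by case: k z => //= -[]. Qed.

Lemma re_partZ a z : re_part (of_real a * z) = a * re_part z.
Proof. by case: k z => //= -[x y] /=; rewrite mul0r subr0. Qed.

Definition abs2 z : R := re_part (z * conj_scalar z).

Lemma mul_conj z : z * conj_scalar z = of_real (abs2 z).
Proof.
rewrite /abs2; case: k z => //= -[x y] /=; apply/eqP.
by rewrite eq_complex /= eqxx mulrN mulrC addNr /=.
Qed.

(** A common coordinate formula for both scalar fields: over the reals the
    second coordinate vanishes identically. *)
Lemma abs2E : exists im : K -> R,
  (forall z, abs2 z = re_part z ^+ 2 + im z ^+ 2) /\
  (forall z, im z = 0 -> re_part z = 0 -> z = 0).
Proof.
rewrite /abs2; case: k => /=.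
  by exists (fun=> 0); split=> // z; rewrite expr0n addr0 expr2.
exists (@complex.Im R); split=> -[x y] /=; first by rewrite mulrN opprK !expr2.
by move=> -> ->.
Qed.

Lemma abs2_ge0 z : 0 <= abs2 z.
Proof. by have [im [-> _]] := abs2E; rewrite addr_ge0 ?sqr_ge0. Qed.

Lemma abs2_eq0 z : abs2 z = 0 -> z = 0.
Proof.
have [im [-> im0]] := abs2E => /eqP.
rewrite paddr_eq0 ?sqr_ge0// !sqrf_eq0 => /andP[/eqP r0 /eqP i0].
exact: im0.
Qed.

(** The expansion of 0 <= |z - conj w|^2. *)
Lemma re_part_mul_le z w : 2 * re_part (z * w) <= abs2 z + abs2 w.
Proof.
have := abs2_ge0 (z - conj_scalar w).
rewrite /abs2 rmorphB /= conj_scalarK mulrBr !mulrBl !raddfB /=.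
rewrite -(re_part_conj (conj_scalar w * conj_scalar z)) rmorphM /= !conj_scalarK.
rewrite (mulrC w z) (mulrC (conj_scalar w) w); lra.
Qed.

End Scalars.

(** A Hermitian matrix is unitarily diagonalizable with real diagonal, and the
    diagonal of a nonzero matrix has a nonzero entry; the corresponding row of
    the unitary matrix is an eigenvector. *)
Lemma complex_hermitian_eigenvalue (R : realType) n (S : 'M[R[i]]_n) :
  S = (map_mx conjc S)^T -> S != 0 ->
  exists2 l : R, l != 0 & eigenvalue S (real_complex R l).
Proof.
move=> Sherm S0.
have Sh : S \is hermsymmx.
  apply/is_hermitianmxP; rewrite expr0 scale1r [LHS]Sherm.
  by apply/matrixP => i j; rewrite !mxE.
have /orthomx_spectralP SE := hermitian_normalmx Sh.
have D0 : spectral_diag S != 0.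
  apply: contra S0 => /eqP D0; apply/eqP; rewrite SE D0.
  suff -> : diag_mx (0 : 'rV[R[i]]_n) = 0 by rewrite mulmx0 mul0mx.
  by apply/matrixP => i j; rewrite !mxE mul0rn.
have /rV0Pn[j Dj] := D0.
have Dreal : spectral_diag S 0 j \is Num.real.
  exact: (mxOverP (hermitian_spectral_diag_real Sh)).
have [l lE] := complex_realP _ Dreal.
exists l; first by apply: contra Dj => /eqP l0; rewrite lE l0.
apply/eigenvalueP; exists (delta_mx 0 j *m spectralmx S).
  rewrite {2}SE !mulmxA mulmxK ?spectral_unit//.
  rewrite scalemxAl -lE; congr (_ *m _).
  by rewrite -rowE row_diag_mx.
apply/eqP => /(congr1 (mulmx^~ (invmx (spectralmx S)))).
rewrite mulmxK ?spectral_unit// mul0mx => /matrixP/(_ 0 j)/eqP.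
by rewrite !mxE !eqxx oner_eq0.
Qed.

(** Over the reals, the eigenvalues come from the complexification: they are
    real roots of the characteristic polynomial, hence eigenvalues already
    over the base field. *)
Lemma hermitian_eigenvalue (R : realType) k n (S : 'M[scalar_field R k]_n) :
  S = adjoint S -> S != 0 ->
  exists2 l : R, l != 0 & eigenvalue S (of_real l).
Proof.
case: k S => /= S Sh S0; last exact: complex_hermitian_eigenvalue.
have [||l l0 ev] := @complex_hermitian_eigenvalue R n (map_mx (real_complex R) S).
- apply/matrixP => i j; rewrite [in LHS]Sh !mxE.
  exact/esym/conjc_real.
- by rewrite map_mx_eq0.
exists l => //; move: ev; rewrite !eigenvalue_root_char -map_char_poly.
by rewrite fmorph_root.
Qed.

(** * Adjoints and the real inner product *)

Section Adjoint.
Variables (R : realType) (k : scalars).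
Local Notation K := (scalar_field R k).

Lemma adjoint_is_zmod_morphism m n :
  zmod_morphism (@adjoint R k m n).
Proof. by move=> A B; apply/matrixP => i j; rewrite !mxE rmorphB. Qed.

HB.instance Definition _ m n := GRing.isZmodMorphism.Build
  'M[K]_(m, n) 'M[K]_(n, m) (@adjoint R k m n) (@adjoint_is_zmod_morphism m n).

Lemma adjointK m n (A : 'M[K]_(m, n)) : adjoint (adjoint A) = A.
Proof. by apply/matrixP => i j; rewrite !mxE conj_scalarK. Qed.

Lemma adjointM m n p (A : 'M[K]_(m, n)) (B : 'M[K]_(n, p)) :
  adjoint (A *m B) = adjoint B *m adjoint A.
Proof. by rewrite /adjoint map_mxM trmx_mul. Qed.

Lemma adjointZ m n (c : K) (A : 'M[K]_(m, n)) :
  adjoint (c *: A) = conj_scalar c *: adjoint A.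
Proof. by apply/matrixP => i j; rewrite !mxE rmorphM. Qed.

Lemma adjointZr m n (a : R) (A : 'M[K]_(m, n)) :
  adjoint (of_real a *: A) = of_real a *: adjoint A.
Proof. by rewrite adjointZ conj_of_real. Qed.

Lemma adjoint_real_diag n (s : 'rV[R]_n) :
  adjoint (real_diag s) = real_diag s :> 'M[K]_n.
Proof.
apply/matrixP => i j; rewrite !mxE; case: (eqVneq i j) => [->|_].
  by rewrite !mulr1n conj_of_real.
by rewrite !mulr0n rmorph0.
Qed.

(** The real inner product underlying the Frobenius norm. *)
Definition rdot m n (A B : 'M[K]_(m, n)) : R := re_part (inner A B).

Lemma inner_conj m n (A B : 'M[K]_(m, n)) :
  inner B A = conj_scalar (inner A B).
Proof.
rewrite /inner -[in LHS](adjointK B) -adjointM.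
by rewrite /adjoint mxtrace_tr trace_map_mx.
Qed.

Lemma rdotC m n (A B : 'M[K]_(m, n)) : rdot A B = rdot B A.
Proof. by rewrite /rdot inner_conj re_part_conj. Qed.

Lemma inner0l m n (A : 'M[K]_(m, n)) : inner 0 A = 0.
Proof. by rewrite /inner mul0mx mxtrace0. Qed.

Lemma innerBl m n (A B C : 'M[K]_(m, n)) :
  inner (A - B) C = inner A C - inner B C.
Proof. by rewrite /inner mulmxBl raddfB. Qed.

Lemma innerDl m n (A B C : 'M[K]_(m, n)) :
  inner (A + B) C = inner A C + inner B C.
Proof. by rewrite /inner mulmxDl raddfD. Qed.

Lemma innerZl m n c (A B : 'M[K]_(m, n)) :
  inner (c *: A) B = c * inner A B.
Proof. by rewrite /inner -scalemxAl mxtraceZ. Qed.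

Lemma rdotBl m n (A B C : 'M[K]_(m, n)) :
  rdot (A - B) C = rdot A C - rdot B C.
Proof. by rewrite /rdot innerBl raddfB. Qed.

Lemma rdotZl m n (a : R) (A B : 'M[K]_(m, n)) :
  rdot (of_real a *: A) B = a * rdot A B.
Proof. by rewrite /rdot innerZl re_partZ. Qed.

Lemma inner_entries m n (A : 'M[K]_(m, n)) :
  inner A A = of_real (\sum_i \sum_j abs2 (A i j)).
Proof.
rewrite /inner /mxtrace rmorph_sum; apply: eq_bigr => i _.
rewrite mxE rmorph_sum; apply: eq_bigr => j _.
by rewrite !mxE mul_conj.
Qed.

Lemma inner_self m n (A : 'M[K]_(m, n)) : inner A A = of_real (rdot A A).
Proof. by rewrite /rdot inner_entries re_part_of_real. Qed.

Lemma rdot_ge0 m n (A : 'M[K]_(m, n)) : 0 <= rdot A A.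
Proof.
rewrite /rdot inner_entries re_part_of_real.
by do 2!apply: sumr_ge0 => ? _; exact: abs2_ge0.
Qed.

Lemma rdot_eq0 m n (A : 'M[K]_(m, n)) : rdot A A = 0 -> A = 0.
Proof.
rewrite /rdot inner_entries re_part_of_real => A0.
apply/matrixP => i j; rewrite mxE; apply: abs2_eq0; apply/eqP.
have := A0 => /eqP; rewrite psumr_eq0 => [|i' _]; last first.
  by apply: sumr_ge0 => ? _; exact: abs2_ge0.
move=> /allP/(_ i (mem_index_enum _)) /=; rewrite psumr_eq0 => [|? _].
  by move=> /allP/(_ j (mem_index_enum _)).
exact: abs2_ge0.
Qed.

Lemma frobenius_sq m n (A : 'M[K]_(m, n)) : frobenius A ^+ 2 = rdot A A.
Proof. by rewrite sqr_sqrtr ?rdot_ge0. Qed.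

Lemma rdot_sub_sub m n (A B : 'M[K]_(m, n)) :
  rdot (A - B) (A - B) = rdot A A - 2 * rdot A B + rdot B B.
Proof.
by rewrite rdotBl (rdotC A) (rdotC B) !rdotBl (rdotC B A); ring.
Qed.

Lemma gram_eq0 m n (A : 'M[K]_(m, n)) : adjoint A *m A = 0 -> A = 0.
Proof.
move=> A0; apply: rdot_eq0.
by rewrite /rdot /inner mxtrace_mulC A0 mxtrace0 raddf0.
Qed.

Lemma gram_col n (u : 'cV[K]_n) : adjoint u *m u = (of_real (rdot u u))%:M.
Proof.
rewrite [LHS]mx11_scalar -inner_self /inner mxtrace_mulC.
by rewrite /mxtrace big_ord1.
Qed.

Lemma normalize_col n (x : 'cV[K]_n) : x != 0 ->
  exists2 a : R, 0 < a &
    adjoint (of_real a *: x) *m (of_real a *: x) = 1%:M.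
Proof.
move=> x0; have xx : 0 < rdot x x.
  rewrite lt_neqAle rdot_ge0 andbT eq_sym.
  by apply: contra x0 => /eqP/rdot_eq0->.
exists (Num.sqrt (rdot x x))^-1; first by rewrite invr_gt0 sqrtr_gt0.
rewrite gram_col; congr (_%:M).
rewrite rdotZl rdotC rdotZl mulrA -invfM -expr2 sqr_sqrtr ?rdot_ge0//.
by rewrite mulVf ?gt_eqF// rmorph1.
Qed.

End Adjoint.

(** * Existence of singular value decompositions *)

Section SVDExistence.
Variables (R : realType) (k : scalars).
Local Notation K := (scalar_field R k).

(** The columns of U span too small a space to have a trivial orthogonal
    complement. *)
Lemma orthonormal_extension m r (U : 'M[K]_(m, r)) : (r < m)%N ->
  exists u : 'cV[K]_m, adjoint u *m u = 1%:M /\ adjoint U *m u = 0.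
Proof.
move=> rm; pose v := nz_row (kermx U).
have v0 : v != 0.
  rewrite nz_row_eq0 -mxrank_eq0 mxrank_ker subn_eq0 -ltnNge.
  by rewrite (leq_ltn_trans (rank_leq_col U)).
have vU : v *m U = 0 by apply/sub_kermxP/nz_row_sub.
have av0 : adjoint v != 0.
  by apply: contra v0 => /eqP av; rewrite -(adjointK v) av raddf0.
have [a _ ha] := normalize_col av0.
exists (of_real a *: adjoint v); split=> //.
by rewrite -scalemxAr -adjointM vU raddf0 scaler0.
Qed.

(** A new singular pair, orthogonal to those already split off. If E <> 0, then
    E^* E is Hermitian and nonzero, hence has a unit eigenvector v with
    eigenvalue l <> 0, and l = |E v|^2 > 0. One takes a = sqrt l and u = E v / a;
    orthogonality to V holds because l V^* v = (E V)^* E v = 0. *)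
Lemma singular_pair m n r (E : 'M[K]_(m, n)) (U : 'M[K]_(m, r))
    (V : 'M[K]_(n, r)) :
  (r < m)%N -> (r < n)%N -> adjoint U *m E = 0 -> E *m V = 0 ->
  exists (u : 'cV[K]_m) (v : 'cV[K]_n) (a : R),
    [/\ 0 <= a, adjoint u *m u = 1%:M /\ adjoint U *m u = 0,
        adjoint v *m v = 1%:M /\ adjoint V *m v = 0,
        E *m v = of_real a *: u & adjoint E *m u = of_real a *: v].
Proof.
move=> rm rn UE EV; have [E0|E0] := eqVneq E 0.
  have [u [uu Uu]] := orthonormal_extension U rm.
  have [v [vv Vv]] := orthonormal_extension V rn.
  exists u, v, 0; split=> //; by rewrite E0 !raddf0 !mul0mx scale0r.
pose S := adjoint E *m E.
have Sh : S = adjoint S by rewrite adjointM adjointK.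
have S0 : S != 0 by apply: contra_neq E0 => /gram_eq0.
have [l l0 /eigenvalueP[w wS w0]] := hermitian_eigenvalue Sh S0.
have Sx0 : S *m adjoint w = of_real l *: adjoint w.
  by rewrite {1}Sh -adjointM wS adjointZr.
have aw0 : adjoint w != 0.
  by apply: contra w0 => /eqP aw; rewrite -(adjointK w) aw raddf0.
have [a a0 vv] := normalize_col aw0.
set v := of_real a *: adjoint w in vv.
have Sv : S *m v = of_real l *: v.
  by rewrite /v -scalemxAr Sx0 !scalerA mulrC.
have gE : adjoint (E *m v) *m (E *m v) = (of_real l)%:M.
  rewrite adjointM -mulmxA (mulmxA (adjoint E)) -/S Sv -scalemxAr vv.
  by rewrite scalemx1.
have lE : l = rdot (E *m v) (E *m v).
  move: gE; rewrite gram_col => /matrixP/(_ 0 0)/(congr1 re_part).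
  by rewrite !mxE !eqxx !mulr1n !re_part_of_real.
have l_gt0 : 0 < l by rewrite lt_neqAle eq_sym l0 lE rdot_ge0.
pose b := Num.sqrt l.
have b0 : 0 < b by rewrite sqrtr_gt0.
have bb : b * b = l by rewrite -expr2 sqr_sqrtr // ltW.
have bK : of_real b != 0 :> K.
  by rewrite fmorph_eq0 gt_eqF.
have lK : of_real l != 0 :> K by rewrite fmorph_eq0.
exists (of_real b^-1 *: (E *m v)), v, b; split=> //.
- exact: ltW.
- split; last by rewrite -scalemxAr mulmxA UE mul0mx scaler0.
  rewrite adjointZr -scalemxAl -scalemxAr gE scalerA -rmorphM /= -invfM bb.
  by rewrite scale_scalar_mx -rmorphM /= mulVf // rmorph1.
- split=> //; have : of_real l *: (adjoint V *m v) = 0.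
    rewrite scalemxAr -Sv mulmxA mulmxA -adjointM EV raddf0 mul0mx mul0mx //.
  by move/eqP; rewrite scaler_eq0 (negPf lK) => /eqP.
- by rewrite scalerA -rmorphM /= mulfV ?gt_eqF// rmorph1 scale1r.
- rewrite -scalemxAr mulmxA -/S Sv scalerA -rmorphM /= -bb mulrA.
  by rewrite mulVf ?gt_eqF// mul1r.
Qed.

Lemma adjoint_row_mx m n1 n2 (A : 'M[K]_(m, n1)) (B : 'M[K]_(m, n2)) :
  adjoint (row_mx A B) = col_mx (adjoint A) (adjoint B).
Proof. by rewrite /adjoint map_row_mx tr_row_mx. Qed.

(** Induction on the number r of singular pairs: E is what remains of A, and it
    acts between the orthogonal complements of the columns of V and of U. *)
Lemma partial_svd m n (A : 'M[K]_(m, n)) r : (r <= minn m n)%N ->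
  exists (U : 'M[K]_(m, r)) (s : 'rV[R]_r) (V : 'M[K]_(n, r)) (E : 'M[K]_(m, n)),
    [/\ adjoint U *m U = 1%:M, adjoint V *m V = 1%:M,
        forall j, 0 <= s 0 j, A = U *m real_diag s *m adjoint V + E
      & adjoint U *m E = 0 /\ E *m V = 0].
Proof.
elim: r => [_|r IH rmn].
  exists 0, 0, 0, A; split.
  - by apply/matrixP => -[].
  - by apply/matrixP => -[].
  - by case.
  - by rewrite mul0mx mul0mx add0r.
  - by rewrite raddf0 mul0mx mulmx0.
have [U [s [V [E [UU VV s0 AE [UE EV]]]]]] := IH (ltnW rmn).
move: rmn; rewrite leq_min => /andP[rm rn].
have [u [v [a [a0 [uu Uu] [vv Vv] Ev Eu]]]] := singular_pair rm rn UE EV.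
have uE : adjoint u *m E = of_real a *: adjoint v.
  by rewrite -[E]adjointK -adjointM Eu adjointZr.
have uU : adjoint u *m U = 0 by rewrite -[U]adjointK -adjointM Uu raddf0.
have vV : adjoint v *m V = 0 by rewrite -[V]adjointK -adjointM Vv raddf0.
rewrite -[r.+1]add1n.
exists (row_mx u U : 'M[K]_(m, 1 + r)), (row_mx a%:M s : 'rV[R]_(1 + r)),
  (row_mx v V : 'M[K]_(n, 1 + r)), (E - of_real a *: (u *m adjoint v)); split.
- rewrite adjoint_row_mx mul_col_row uu UU uU Uu.
  by rewrite -(@scalar_mx_block _ 1 r).
- rewrite adjoint_row_mx mul_col_row vv VV vV Vv.
  by rewrite -(@scalar_mx_block _ 1 r).
- move=> j; case: (split_ordP j) => i ->.
    by rewrite row_mxEl ord1 !mxE eqxx.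
  by rewrite row_mxEr.
- rewrite /real_diag map_row_mx diag_mx_row adjoint_row_mx mul_row_block.
  rewrite !mulmx0 addr0 add0r mul_row_col -/(real_diag s).
  have -> : diag_mx (map_mx of_real a%:M) = (of_real a)%:M :> 'M[K]_1.
    by apply/matrixP => i j; rewrite !ord1 !mxE !eqxx !mulr1n.
  rewrite mul_mx_scalar -scalemxAl AE.
  by rewrite [RHS]addrC addrA subrK addrC.
- rewrite adjoint_row_mx mul_col_mx mul_mx_row !mulmxBr !mulmxBl.
  rewrite -!scalemxAr -!scalemxAl !mulmxA uu Uu mul1mx mul0mx uE UE Ev EV.
  rewrite -!mulmxA vv vV mulmx1 mulmx0 !scaler0 !subrr.
  by rewrite row_mx0 col_mx0.
Qed.

Lemma svd_entry m n r (U : 'M[K]_(m, r)) (s : 'rV[R]_r) (V : 'M[K]_(n, r)) i j :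
  (U *m real_diag s *m adjoint V) i j =
  \sum_l U i l * of_real (s 0 l) * conj_scalar (V j l).
Proof.
rewrite mxE; apply: eq_bigr => l _.
by rewrite mul_mx_diag !mxE.
Qed.

Lemma nonincreasing_perm r (s : 'rV[R]_r) :
  exists p : 'S_r, forall i j : 'I_r, (i <= j)%N -> s 0 (p j) <= s 0 (p i).
Proof.
pose t := [tuple s 0 j | j < r].
have /tuple_permP[p pE] : perm_eq (sort (fun x y : R => y <= x) t) t.
  by rewrite perm_sort.
exists p => i j ij.
have tot : total (fun x y : R => y <= x) by move=> x y; rewrite orbC le_total.
have tr : transitive (fun x y : R => y <= x).
  by move=> x y z h1 h2; exact: le_trans h2 h1.
have := sort_sorted tot t; rewrite pE => /(sorted_leq_nth tr).
move=> /(_ (fun x => lexx x) 0 i j); rewrite !inE !size_tuple !ltn_ord.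
move=> /(_ isT isT ij).
by rewrite -!tnth_nth !tnth_mktuple.
Qed.

(** When the columns of U fill the whole space, no room is left for E. *)
Lemma tight_columns_residual m r (U : 'M[K]_(m, r)) n (E : 'M[K]_(m, n)) :
  r = m -> adjoint U *m U = 1%:M -> adjoint U *m E = 0 -> E = 0.
Proof.
move=> rm; subst r => UU UE.
by rewrite -[E]mul1mx -(mulmx1C UU) -mulmxA UE mulmx0.
Qed.

(** With min(m, n) pairs split off, U or V is square and unitary, so the
    remainder vanishes; a permutation of the columns then sorts the singular
    values. *)
Theorem svd_exists m n (A : 'M[K]_(m, n)) : exists U s V, is_svd A U s V.
Proof.
have [U [s [V [E [UU VV s0 AE [UE EV]]]]]] := partial_svd A (leqnn (minn m n)).
have E0 : E = 0.
  have [mn|nm] := leqP m n.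
    by apply: (tight_columns_residual _ UU UE); apply/minn_idPl.
  suff Ea : adjoint E = 0 by rewrite -[E]adjointK Ea raddf0.
  apply: (tight_columns_residual _ VV); first exact/minn_idPr/ltnW.
  by rewrite -adjointM EV raddf0.
have [p pE] := nonincreasing_perm s.
have onb q (X : 'M[K]_(q, minn m n)) : adjoint X *m X = 1%:M ->
    adjoint (col_perm p X) *m col_perm p X = 1%:M.
  move=> XX; apply/matrixP => i j.
  have := XX => /matrixP/(_ (p i) (p j)); rewrite !mxE (inj_eq perm_inj) => <-.
  by apply: eq_bigr => l _; rewrite !mxE.
exists (col_perm p U), (col_perm p s), (col_perm p V); split; try exact: onb.
- by move=> j; rewrite mxE.
- by move=> i j ij; rewrite !mxE pE.
rewrite AE E0 addr0; apply/matrixP => i j; rewrite !svd_entry.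
rewrite (reindex_inj (@perm_inj _ p)).
by apply: eq_bigr => l _; rewrite !mxE.
Qed.

Lemma sing_val_svd m n (A : 'M[K]_(m, n)) :
  is_svd A (svd A).1.1 (sing_val A) (svd A).2.
Proof.
rewrite /sing_val /svd; case: xgetP => [D -> //|noD].
by have [U [s [V]]] := svd_exists A; move/(noD (U, s, V)).
Qed.

End SVDExistence.

(** * Functional calculus and uniqueness of singular values *)

Section SVDUniqueness.
Variables (R : realType) (k : scalars).
Local Notation K := (scalar_field R k).

(** The functional calculus for a factorization U diag(s) V^* that need not come
    from the chosen decomposition. *)
Definition svd_map (f : R -> R) m n r (U : 'M[K]_(m, r)) (s : 'rV[R]_r)
  (V : 'M[K]_(n, r)) := U *m real_diag (map_mx f s) *m adjoint V.

Lemma real_diagM r (s t : 'rV[R]_r) :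
  real_diag s *m real_diag t = real_diag (\row_j (s 0 j * t 0 j)) :> 'M[K]_r.
Proof.
rewrite mulmx_diag; congr diag_mx.
by apply/matrixP => i j; rewrite !mxE rmorphM.
Qed.

Section TwoSVDs.
Variables (m n : nat) (A : 'M[K]_(m, n)).
Variables (U U' : 'M[K]_(m, minn m n)) (V V' : 'M[K]_(n, minn m n)).
Variables s t : 'rV[R]_(minn m n).
Hypotheses (svdA : is_svd A U s V) (svdA' : is_svd A U' t V').

(** With P = U'^* U and Q = V'^* V, computing U'^* A V and V'^* A^* U in the two
    decompositions gives T Q = P S and T P = Q S. Hence the (i, j) entries of P
    and Q are equal when t_i = s_j <> 0, and both vanish when t_i <> s_j, since
    (s_j^2 - t_i^2) annihilates them. The entries with t_i = s_j = 0 are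
    arbitrary, but there f(0) = 0 removes them. *)
Lemma svd_intertwine (f : R -> R) : f 0 = 0 ->
  real_diag (map_mx f t) *m (adjoint V' *m V) =
  adjoint U' *m U *m real_diag (map_mx f s).
Proof.
move=> f0; case: svdA => UU VV s0 _ AE; case: svdA' => UU' VV' t0 _ AE'.
set Q := adjoint V' *m V; set P := adjoint U' *m U.
have AV : A *m V = U *m real_diag s by rewrite AE -!mulmxA VV mulmx1.
have UA : adjoint U' *m A = real_diag t *m adjoint V'.
  by rewrite AE' !mulmxA UU' mul1mx.
have AV' : adjoint V' *m adjoint A = real_diag t *m adjoint U'.
  by rewrite -adjointM AE' -!mulmxA VV' mulmx1 adjointM adjoint_real_diag.
have UA' : adjoint A *m U = V *m real_diag s.
  by rewrite -[U]adjointK -adjointM AE !mulmxA UU mul1mx adjointM adjointK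
    adjoint_real_diag.
have e1 : real_diag t *m Q = P *m real_diag s.
  by rewrite mulmxA -UA -mulmxA AV mulmxA.
have e2 : real_diag t *m P = Q *m real_diag s.
  by rewrite mulmxA -AV' -mulmxA UA' mulmxA.
clearbody Q P.
apply/matrixP => i j; rewrite mul_diag_mx mul_mx_diag !mxE.
have {e1} := e1 => /matrixP/(_ i j); rewrite mul_diag_mx mul_mx_diag !mxE => e1.
have {e2} := e2 => /matrixP/(_ i j); rewrite mul_diag_mx mul_mx_diag !mxE => e2.
have [st|st] := eqVneq (s 0 j) (t 0 i).
  move: e1; rewrite -st; have [->|sj0] := eqVneq (s 0 j) 0.
    by rewrite f0 rmorph0 mul0r mulr0.
  have sjK : of_real (s 0 j) != 0 :> K by rewrite fmorph_eq0.
  by rewrite mulrC => /(mulIf sjK) ->; rewrite mulrC.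
have dif : of_real (s 0 j ^+ 2 - t 0 i ^+ 2) != 0 :> K.
  rewrite fmorph_eq0 subr_sqr mulf_neq0 ?subr_eq0//.
  rewrite paddr_eq0 //; apply: contra st => /andP[/eqP-> /eqP->].
  by [].
have Q0 : Q i j = 0.
  apply: (mulfI dif); rewrite mulr0 rmorphB /= !rmorphXn /= mulrBl.
  rewrite !expr2 -!mulrA e1.
  rewrite [of_real (t 0 i) * _]mulrA e2; ring.
have P0 : P i j = 0.
  apply: (mulfI dif); rewrite mulr0 rmorphB /= !rmorphXn /= mulrBl.
  rewrite !expr2 -!mulrA e2.
  rewrite [of_real (t 0 i) * _]mulrA e1; ring.
by rewrite Q0 P0 mulr0 mul0r.
Qed.

(** Since f(0) = 0, both matrices factor through A: U U^* and U' U'^* fix the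
    columns of A, V V^* and V' V'^* its rows. So U f(S) V^* is fixed by U' U'^* on
    the left and U' f(T) V'^* by V V^* on the right, and [svd_intertwine]
    identifies the two projected matrices. *)
Lemma svd_map_unique (f : R -> R) : f 0 = 0 ->
  svd_map f U s V = svd_map f U' t V'.
Proof.
move=> f0; have fQ := svd_intertwine f0.
case: svdA => UU VV s0 _ AE; case: svdA' => UU' VV' t0 _ AE'.
(* f x = g x * x, as f 0 = 0 and 0 / 0 = 0 *)
pose g x := f x / x.
have fg r (x : 'rV[R]_r) :
    real_diag (map_mx f x) = real_diag (map_mx g x) *m real_diag x :> 'M[K]_r.
  rewrite real_diagM; congr (real_diag _); apply/matrixP => i j.
  rewrite ord1 !mxE /g; have [->|x0] := eqVneq (x 0 j) 0; first by rewrite f0 mulr0.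
  by rewrite divfK.
have gC r (x : 'rV[R]_r) : real_diag (map_mx g x) *m real_diag x =
    real_diag x *m real_diag (map_mx g x) :> 'M[K]_r.
  rewrite !real_diagM; congr (real_diag _).
  by apply/matrixP => i j; rewrite !mxE mulrC.
have colA : U' *m (adjoint U' *m svd_map f U s V) = svd_map f U s V.
  have -> : svd_map f U s V = A *m (V *m real_diag (map_mx g s) *m adjoint V).
    by rewrite /svd_map fg gC AE -!mulmxA (mulmxA (adjoint V) V) VV mul1mx.
  by rewrite AE' -!mulmxA (mulmxA (adjoint U') U') UU' mul1mx.
have rowA : svd_map f U' t V' *m V *m adjoint V = svd_map f U' t V'.
  have -> : svd_map f U' t V' = U' *m real_diag (map_mx g t) *m adjoint U' *m A.
    by rewrite /svd_map fg AE' -!mulmxA (mulmxA (adjoint U') U') UU' mul1mx.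
  by rewrite AE -!mulmxA (mulmxA (adjoint V) V) VV mul1mx.
rewrite -rowA -colA {1 2}/svd_map !mulmxA; congr (_ *m _).
by rewrite -!mulmxA fQ !mulmxA.
Qed.

End TwoSVDs.

Lemma rdot_svd_map (f g : R -> R) m n r (U : 'M[K]_(m, r)) (s : 'rV[R]_r)
    (V : 'M[K]_(n, r)) :
  adjoint U *m U = 1%:M -> adjoint V *m V = 1%:M ->
  rdot (svd_map f U s V) (svd_map g U s V) = \sum_j f (s 0 j) * g (s 0 j).
Proof.
move=> UU VV; rewrite /rdot /inner /svd_map !adjointM adjointK adjoint_real_diag.
rewrite -!mulmxA (mulmxA (adjoint V)) VV mul1mx mxtrace_mulC -!mulmxA UU mulmx1.
rewrite real_diagM mxtrace_diag raddf_sum; apply: eq_bigr => j _.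
by rewrite !mxE /= re_part_of_real.
Qed.

(** If t_j < s_j, apply the functional calculus to the indicator function of
    ]t_j, +oo[: it counts the singular values above t_j, at least j + 1 in one
    list but at most j in the other, while the count is a squared norm which does
    not depend on the decomposition. *)
Lemma is_svd_le m n (A : 'M[K]_(m, n)) U s V U' t V' j :
  is_svd A U s V -> is_svd A U' t V' -> s 0 j <= t 0 j.
Proof.
move=> svdA svdA'; rewrite leNgt; apply/negP => tsj.
pose f (x : R) : R := (t 0 j < x)%R%:R.
have := svdA' => -[UU' VV' t0 tle _]; have := svdA => -[UU VV s0 sle _].
have f0 : f 0 = 0 by rewrite /f ltNge t0.
have := rdot_svd_map f f s UU VV; rewrite (svd_map_unique svdA svdA' f0).
rewrite rdot_svd_map// => /eqP; rewrite lt_eqF//.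
rewrite (bigD1 j) //= [ltRHS](bigD1 j) //=; apply: ltr_leD.
  by rewrite /f ltxx tsj mul0r mulr1 ltr01.
apply: ler_sum => i _; rewrite /f.
case: (leqP i j) => [ij|ji].
  rewrite (lt_le_trans tsj (sle _ _ ij)) mulr1.
  by case: (_ < _); rewrite ?mulr1 // mulr0 ler01.
by rewrite [t 0 j < t 0 i]ltNge tle ?(ltnW ji)// mulr0 -expr2 sqr_ge0.
Qed.

Lemma sing_valE m n (A : 'M[K]_(m, n)) U s V : is_svd A U s V -> sing_val A = s.
Proof.
move=> svdA; apply/matrixP => i j; rewrite ord1; apply/eqP; rewrite eq_le.
by rewrite !(is_svd_le _ (sing_val_svd A) svdA, is_svd_le _ svdA (sing_val_svd A)).
Qed.

End SVDUniqueness.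

(** * A trace inequality of Fenchel type *)

Section TraceInequality.
Variables (R : realType) (k : scalars).
Local Notation K := (scalar_field R k).

Lemma abs2_conj (z : K) : abs2 (conj_scalar z) = abs2 z.
Proof. by rewrite /abs2 conj_scalarK mulrC. Qed.

(** Bessel's inequality: for Q = Y^* V, the Gram matrix of V - Y Q is 1 - Q^* Q,
    and its diagonal is nonnegative. *)
Lemma bessel n p r (Y : 'M[K]_(n, p)) (V : 'M[K]_(n, r)) i :
  adjoint Y *m Y = 1%:M -> adjoint V *m V = 1%:M ->
  \sum_j abs2 ((adjoint Y *m V) j i) <= 1.
Proof.
move=> YY VV; set Q := adjoint Y *m V.
have gram q (Z : 'M[K]_(q, r)) :
    (adjoint Z *m Z) i i = of_real (\sum_j abs2 (Z j i)).
  rewrite mxE rmorph_sum; apply: eq_bigr => j _.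
  by rewrite !mxE mulrC mul_conj.
have : adjoint (V - Y *m Q) *m (V - Y *m Q) = 1%:M - adjoint Q *m Q.
  have VY : adjoint V *m Y = adjoint Q by rewrite /Q adjointM adjointK.
  rewrite [adjoint (_ - _)]raddfB /= (adjointM Y Q) mulmxBl !mulmxBr VV.
  rewrite -!(mulmxA (adjoint Q)) (mulmxA (adjoint Y)) YY mul1mx -/Q.
  by rewrite subrr subr0 mulmxA VY.
move/(congr1 (+%R^~ (adjoint Q *m Q))); rewrite /= subrK => /matrixP/(_ i i).
rewrite [LHS]mxE !gram [RHS]mxE eqxx mulr1n -rmorphD /= => /(congr1 re_part).
rewrite -(rmorph1 (@of_real R k)) !re_part_of_real => <-.
by rewrite lerDr; apply: sumr_ge0 => j _; exact: abs2_ge0.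
Qed.

(** Expanding both decompositions, <B, W> is the sum of b_j w_i Q_ji P_ij with
    Q = Y^* V and P = U^* X. The weights p_ji = (|Q_ji|^2 + |P_ij|^2) / 2 dominate
    Re (Q_ji P_ij) and form a doubly substochastic matrix by [bessel]. Applying
    2 x y <= g(x) + h(y) to each pair and using g, h >= 0 gives the bound; this
    replaces von Neumann's trace inequality, without rearrangement. *)
Lemma trace_fenchel (g h : R -> R) m n (B W : 'M[K]_(m, n)) :
  (forall x, 0 <= x -> 0 <= g x) -> (forall x, 0 <= x -> 0 <= h x) ->
  (forall x y, 0 <= x -> 0 <= y -> 2 * (x * y) <= g x + h y) ->
  2 * rdot B W <=
  \sum_j g (sing_val B 0 j) + \sum_j h (sing_val W 0 j).
Proof.
move=> g0 h0 gh.
have := sing_val_svd B; set X := (svd B).1.1; set Y := (svd B).2.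
set b := sing_val B => -[XX YY b0 _ BE].
have := sing_val_svd W; set U := (svd W).1.1; set V := (svd W).2.
set w := sing_val W => -[UU VV w0 _ WE].
set Q := adjoint Y *m V; set P := adjoint U *m X.
have -> : rdot B W =
    \sum_j \sum_i (b 0 j * w 0 i) * re_part (Q j i * P i j).
  rewrite /rdot /inner BE WE !adjointM adjointK adjoint_real_diag.
  rewrite -!mulmxA mxtrace_mulC -!mulmxA -/P (mulmxA (adjoint Y)) -/Q.
  rewrite /mxtrace raddf_sum; apply: eq_bigr => j _ /=.
  rewrite mul_diag_mx mxE mxE [X in _ * X]mxE mulr_sumr raddf_sum.
  apply: eq_bigr => i _ /=.
  clearbody P Q; rewrite mul_diag_mx !mxE.
  rewrite -re_partZ rmorphM /=; congr re_part; ring.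
have Qc i : \sum_j abs2 (Q j i) <= 1 by exact: bessel.
have Pc j : \sum_i abs2 (P i j) <= 1 by exact: bessel.
have Qr j : \sum_i abs2 (Q j i) <= 1.
  apply: le_trans (bessel j VV YY); apply: ler_sum => i _.
  by rewrite -[Q]adjointK adjointM adjointK [adjoint _ _ _]mxE mxE abs2_conj.
have Pr i : \sum_j abs2 (P i j) <= 1.
  apply: le_trans (bessel i XX UU); apply: ler_sum => j _.
  by rewrite -[P]adjointK adjointM adjointK [adjoint _ _ _]mxE mxE abs2_conj.
apply: (@le_trans _ _ (\sum_j \sum_i (g (b 0 j) + h (w 0 i)) *
    ((abs2 (Q j i) + abs2 (P i j)) / 2))).
  rewrite mulr_sumr; apply: ler_sum => j _.
  rewrite mulr_sumr; apply: ler_sum => i _.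
  have bw := gh _ _ (b0 j) (w0 i).
  have qp := re_part_mul_le (Q j i) (P i j).
  have q0 := abs2_ge0 (Q j i); have p0 := abs2_ge0 (P i j).
  have bw0 := mulr_ge0 (b0 j) (w0 i).
  set c := b 0 j * w 0 i in bw bw0 *.
  apply: (@le_trans _ _ (2 * (c * ((abs2 (Q j i) + abs2 (P i j)) / 2)))).
    by rewrite ler_pM2l// ler_wpM2l// ler_pdivlMr// mulrC.
  by rewrite mulrA ler_wpM2r// divr_ge0// addr_ge0.
pose p j i := (abs2 (Q j i) + abs2 (P i j)) / 2.
have p1 j : \sum_i p j i <= 1.
  by rewrite -mulr_suml big_split /= ler_pdivrMr// mul1r;
    apply: lerD (Qr j) (Pc j).
have p2 i : \sum_j p j i <= 1.
  by rewrite -mulr_suml big_split /= ler_pdivrMr// mul1r;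
    apply: lerD (Qc i) (Pr i).
under eq_bigr do under eq_bigr do rewrite mulrDl.
under eq_bigr do rewrite big_split /=.
rewrite big_split /=; apply: lerD.
  apply: ler_sum => j _; rewrite -mulr_sumr -[leRHS]mulr1.
  by apply: ler_wpM2l (p1 j); exact: g0.
rewrite exchange_big /=; apply: ler_sum => i _; rewrite -mulr_sumr -[leRHS]mulr1.
by apply: ler_wpM2l (p2 i); exact: h0.
Qed.

End TraceInequality.

(** * Rank *)

Lemma rank_diag_mx (F : fieldType) n (d : 'rV[F]_n) :
  \rank (diag_mx d) = (\sum_j (d 0 j != 0)%R)%N.
Proof.
elim: n d => [d|n IH]; first by rewrite big_ord0 flatmx0 mxrank0.
rewrite -[n.+1]add1n => d; rewrite big_split_ord big_ord1 /=.
rewrite -[in LHS](hsubmxK d) diag_mx_row rank_diag_block_mx IH; congr (_ + _)%N.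
  rewrite rank_rV; congr (nat_of_bool (~~ _)).
  apply/eqP/eqP => [/matrixP/(_ 0 0)|d0]; first by rewrite !mxE eqxx mulr1n.
  by apply/matrixP => i j; rewrite !ord1 !mxE eqxx mulr1n.
by apply: eq_bigr => j _; rewrite mxE.
Qed.

Section Rank.
Variables (R : realType) (k : scalars).
Local Notation K := (scalar_field R k).

(** U^* A V = diag(sigma), so A and the diagonal matrix bound the rank of each
    other. *)
Lemma rank_svd m n (A : 'M[K]_(m, n)) :
  \rank A = (\sum_j (sing_val A 0 j != 0)%R)%N.
Proof.
have := sing_val_svd A; set U := (svd A).1.1; set V := (svd A).2.
move=> [UU VV s0 _ AE].
have -> : (\sum_j (sing_val A 0 j != 0)%R)%N =
    \rank (real_diag (sing_val A) : 'M[K]_ _).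
  by rewrite rank_diag_mx; apply: eq_bigr => j _; rewrite mxE fmorph_eq0.
apply/eqP; rewrite eqn_leq; apply/andP; split.
  by rewrite [in X in (X <= _)%N]AE (leq_trans (mxrankM_maxl _ _))// mxrankM_maxr.
have -> : real_diag (sing_val A) = adjoint U *m A *m V :> 'M[K]_ _.
  by rewrite [in RHS]AE !mulmxA UU mul1mx -mulmxA VV mulmx1.
by rewrite (leq_trans (mxrankM_maxl _ _))// mxrankM_maxr.
Qed.

End Rank.

(** * Orthogonal projections *)

Section Projection.
Variables (R : realType) (k : scalars) (m n : nat).
Local Notation K := (scalar_field R k).
Implicit Types (E : set 'M[K]_(m, n)) (W B : 'M[K]_(m, n)).

Lemma inner_suml I (r : seq I) (F : I -> 'M[K]_(m, n)) B :
  inner (\sum_(i <- r) F i) B = \sum_(i <- r) inner (F i) B.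
Proof.
elim/big_rec2: _ => [|i x y _ <-]; first by rewrite inner0l.
by rewrite innerDl.
Qed.

(** A difference of two candidates lies in E and is orthogonal to E. *)
Lemma orth_projE E W B : (forall X Y, E X -> E Y -> E (X - Y)) ->
  E B -> orthogonal_complement E (W - B) -> orth_proj E W = B.
Proof.
move=> Esub EB WB; rewrite /orth_proj; case: xgetP => [C _ [EC WC]|]; last first.
  by move/(_ B); case.
apply/eqP; rewrite -subr_eq0; apply/eqP/rdot_eq0.
have CB := Esub _ _ EC EB.
have e : C - B = (W - B) - (W - C) by rewrite opprB [RHS]addrC addrA subrK.
rewrite /rdot [X in inner X _]e innerBl.
by rewrite (WB _ CB) (WC _ CB) subrr raddf0.
Qed.

(** The coordinates of the projection solve a linear system whose matrix is the
    Gram matrix G of a basis; G is invertible, as c G = 0 makes the combination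
    with coefficients c orthogonal to H, hence to itself. *)
Lemma orthogonal_decomposition (H : {vspace 'M[K]_(m, n)}) W :
  exists2 B, B \in H & orthogonal_complement [set` H] (W - B).
Proof.
pose b := vbasis H; pose G := \matrix_(i, j) inner b`_i b`_j : 'M[K]_(\dim H).
have inH (c : 'I_(\dim H) -> K) : \sum_i c i *: b`_i \in H.
  by apply: memv_suml => i _; rewrite memvZ// vbasis_mem// mem_nth// size_tuple.
have expand X : X \in H -> exists c : 'I_(\dim H) -> K, X = \sum_i c i *: b`_i.
  by move=> XH; exists (coord b ^~ X); exact: coord_vbasis.
have perp X : (forall j : 'I_(\dim H), inner X b`_j = 0) ->
    orthogonal_complement [set` H] X.
  move=> Xb Y /= /expand[c ->]; rewrite inner_conj inner_suml.
  rewrite big1 ?rmorph0// => j _.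
  by rewrite innerZl inner_conj Xb rmorph0 mulr0.
have gram (c : 'rV[K]_(\dim H)) j :
    (c *m G) 0 j = inner (\sum_i c 0 i *: b`_i) b`_j.
  by rewrite mxE inner_suml; apply: eq_bigr => i _; rewrite innerZl !mxE.
have Gunit : G \in unitmx.
  rewrite -row_free_unit -kermx_eq0; apply/rowV0P => c /sub_kermxP cG.
  have c0 : \sum_i c 0 i *: b`_i = 0.
    apply: rdot_eq0; rewrite /rdot perp ?raddf0// => [j|]; last exact: inH.
    by rewrite -gram cG mxE.
  have /freeP bfree := basis_free (vbasisP H).
  by apply/rowP => j; rewrite (bfree _ c0) mxE.
pose c := \row_j inner W b`_j *m invmx G.
exists (\sum_i c 0 i *: b`_i); first exact: inH.
by apply: perp => j; rewrite innerBl -gram mulmxKV// mxE subrr.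
Qed.

Lemma orth_proj_subspace (H : {vspace 'M[K]_(m, n)}) W :
  [/\ orth_proj [set` H] W \in H,
      orthogonal_complement [set` H] (W - orth_proj [set` H] W)
    & orth_proj (orthogonal_complement [set` H]) W = W - orth_proj [set` H] W].
Proof.
have [B BH WB] := orthogonal_decomposition H W.
have -> : orth_proj [set` H] W = B.
  by apply: orth_projE => //= X Y XH YH; exact: rpredB.
split=> //; apply: orth_projE => //=.
  by move=> X Y XH YH D DH; rewrite innerBl XH// YH// subrr.
by rewrite opprB addrC subrK => X XH; rewrite inner_conj XH// rmorph0.
Qed.

End Projection.

(** * The scalar problem *)

Section ScalarProblem.
Variables (R : realType) (tau q : R).
Hypotheses (tau_gt0 : 0 < tau) (q_gt1 : 1 < q).

(** Applied to the singular values of q F + P_{H^perp}(Wo), it gives those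
    of Ao. *)
Definition shrink (z : R) : R := (z - s_tau_q tau q z) / (q - 1).

Definition penalty (x : R) : R := tau ^+ 2 - Num.max (tau - x) 0 ^+ 2.

(** On y >= 0, the conjugate sup_(x >= 0) (2 x y - penalty x - x ^+ 2). *)
Definition penalty_conj (y : R) : R := Num.max y tau ^+ 2 - tau ^+ 2.

(** The three cases correspond to z <= tau, tau <= z <= q tau and q tau <= z. *)
Lemma s_tau_q_cases (z : R) : 0 <= z ->
  [\/ [/\ z <= tau, s_tau_q tau q z = z & shrink z = 0],
      [/\ s_tau_q tau q z = tau, 0 <= shrink z & shrink z <= tau]
    | [/\ tau <= shrink z & s_tau_q tau q z = shrink z]].
Proof.
move=> z0; have q0 : 0 < q by exact: lt_trans q_gt1.
have q10 : 0 < q - 1 by rewrite subr_gt0.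
have zq : z = q * (z / q) by rewrite mulrC divfK ?gt_eqF.
have zq0 : 0 <= z / q by rewrite divr_ge0// ltW.
have xz : z / q <= z by rewrite ler_pdivrMr// ler_peMr// ltW.
rewrite /shrink /s_tau_q; set x := z / q in zq zq0 xz *.
case: (leP z tau) => zt.
  apply: Or31; split=> //; last first.
    by rewrite max_l ?subrr ?mul0r.
  by rewrite max_l.
case: (leP tau x) => tx.
  have xE : (z - x) / (q - 1) = x.
    by apply/eqP; rewrite eq_sym -subr_eq0 zq; apply/eqP; field; rewrite gt_eqF.
  by apply: Or33; rewrite xE.
apply: Or32; split=> //.
  by rewrite divr_ge0//; lra.
by rewrite ler_pdivrMr//; nra.
Qed.

Lemma s_tau_q_ge0 (z : R) : 0 <= z -> 0 <= s_tau_q tau q z.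
Proof.
have := tau_gt0; move=> ? z0.
by have [[_ -> _]|[-> _ _]|[? ->]] := s_tau_q_cases z0; lra.
Qed.

Lemma shrink_ge0 (z : R) : 0 <= z -> 0 <= shrink z.
Proof.
have := tau_gt0; move=> ? z0.
by have [[_ _ ->]|[_ ? _]|[? _]] := s_tau_q_cases z0; lra.
Qed.

Lemma s_tau_q_nondecreasing : {homo s_tau_q tau q : x y / x <= y}.
Proof.
move=> x y xy; have q0 : 0 <= q^-1 by rewrite invr_ge0 ltW// (lt_trans _ q_gt1).
by rewrite /s_tau_q ge_max !le_max le_min !ge_min xy lexx ler_wpM2r ?orbT//.
Qed.

(** Equivalently s_tau_q is 1-Lipschitz, its slopes being 1, 0 and 1 / q. *)
Lemma shrink_nondecreasing : {homo shrink : x y / x <= y}.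
Proof.
move=> x y xy; apply: ler_wpM2r; first by rewrite invr_ge0 subr_ge0 ltW.
suff h : s_tau_q tau q y <= s_tau_q tau q x + (y - x) by lra.
have qle : y / q <= x / q + (y - x).
  have : (y - x) / q <= y - x.
    by rewrite ler_pdivrMr ?(lt_trans _ q_gt1)// ler_peMr ?subr_ge0// ltW.
  by rewrite mulrBl; lra.
rewrite /s_tau_q; case: (leP x tau) => xt; case: (leP y tau) => yt;
  rewrite ge_max; case: (leP _ (x / q)) => ?; apply/andP; split; lra.
Qed.

Lemma penalty_sqr_ge0 x : 0 <= x -> 0 <= penalty x + x ^+ 2.
Proof.
have := tau_gt0; move=> ? x0; rewrite /penalty; case: (leP (tau - x) 0) => ?; nra.
Qed.

Lemma penalty_conj_ge0 y : 0 <= penalty_conj y.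
Proof.
have := tau_gt0; move=> ?; rewrite /penalty_conj; case: (leP y tau) => ?; nra.
Qed.

Lemma penalty_fenchel x y : 0 <= x -> 0 <= y ->
  2 * (x * y) <= (penalty x + x ^+ 2) + penalty_conj y.
Proof.
have := tau_gt0; move=> ? x0 y0; rewrite /penalty /penalty_conj.
case: (leP (tau - x) 0) => ?; case: (leP y tau) => ?.
- have := sqr_ge0 (x - tau); nra.
- have := sqr_ge0 (x - y); nra.
- nra.
- have : 0 <= (y - tau) * (tau - x) by rewrite mulr_ge0//; lra.
  have := sqr_ge0 (y - tau); nra.
Qed.

(** Equality case of [penalty_fenchel], which makes Ao optimal. *)
Lemma penalty_fenchel_eq (z : R) : 0 <= z ->
  2 * (shrink z * s_tau_q tau q z) =
  (penalty (shrink z) + shrink z ^+ 2) + penalty_conj (s_tau_q tau q z).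
Proof.
move=> z0; rewrite /penalty /penalty_conj.
have [[zt -> ->]|[-> a0 at_]|[ta ->]] := s_tau_q_cases z0.
- rewrite subr0 max_l ?ltW// max_r//; ring.
- by rewrite maxxx max_l ?subr_ge0//; ring.
- by rewrite max_r ?subr_le0// max_l//; ring.
Qed.

Lemma penalty_le x : penalty x <= tau ^+ 2 * (x != 0)%R%:R.
Proof.
rewrite /penalty; have [->|_] /= := eqVneq x 0.
  by rewrite mulr0n mulr0 subr0 max_l ?subrr// ltW.
by rewrite mulr1 lerBlDr lerDl sqr_ge0.
Qed.

Lemma penalty_shrink (z : R) : 0 <= z -> s_tau_q tau q z != tau ->
  penalty (shrink z) = tau ^+ 2 * (shrink z != 0)%R%:R.
Proof.
move=> z0; have [[zt _ ->] _|[-> _ _]|[ta -> _]] := s_tau_q_cases z0.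
- by rewrite eqxx mulr0 /penalty subr0 max_l ?subrr ?ltW.
- by rewrite eqxx.
- rewrite gt_eqF ?(lt_le_trans tau_gt0)// mulr1 /penalty max_r ?subr_le0//.
  by rewrite expr0n subr0.
Qed.

Lemma shrink_trichotomy (z : R) : 0 <= z ->
  [/\ tau < s_tau_q tau q z -> shrink z = s_tau_q tau q z,
      s_tau_q tau q z = tau -> 0 <= shrink z <= s_tau_q tau q z
    & s_tau_q tau q z < tau -> shrink z = 0].
Proof.
have := tau_gt0; move=> ? z0.
have [[zt -> ->]|[-> a0 at_]|[ta ->]] := s_tau_q_cases z0.
- by split=> // [|->]; [lra|rewrite lexx ltW].
- by split=> [|_|]; rewrite ?ltxx ?a0.
- by split=> // [_|]; [rewrite lexx andbT|]; lra.
Qed.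

End ScalarProblem.

(** * The fixed point *)

Section Objective.
Variables (R : realType) (k : scalars) (m n : nat) (tau : R).
Hypothesis tau_gt0 : 0 < tau.
Local Notation K := (scalar_field R k).
Implicit Types (A B W : 'M[K]_(m, n)).

Lemma svd_map_id A U s V : is_svd A U s V -> A = svd_map id U s V.
Proof.
case=> _ _ _ _ {1}->; rewrite /svd_map; congr (_ *m real_diag _ *m _).
by apply/matrixP => i j; rewrite !mxE.
Qed.

Lemma svd_map_svd (f : R -> R) A U s V :
  (forall x, 0 <= x -> 0 <= f x) -> {homo f : x y / x <= y} ->
  is_svd A U s V -> is_svd (svd_map f U s V) U (map_mx f s) V.
Proof.
move=> f0 fle [UU VV s0 sle _]; split=> //.
  by move=> j; rewrite mxE f0.
by move=> i j ij; rewrite !mxE fle// sle.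
Qed.

Lemma rdot_sing_val A : rdot A A = \sum_j sing_val A 0 j ^+ 2.
Proof.
have svdA := sing_val_svd A; rewrite [in LHS](svd_map_id svdA).
by case: svdA => UU VV _ _ _; rewrite rdot_svd_map.
Qed.

Lemma R_tau_add_rdot A :
  R_tau tau A + rdot A A =
  \sum_j (penalty tau (sing_val A 0 j) + sing_val A 0 j ^+ 2).
Proof. by rewrite rdot_sing_val -big_split. Qed.

Lemma sing_val_ge0 A j : 0 <= sing_val A 0 j.
Proof. by case: (sing_val_svd A). Qed.

(** Fenchel duality: expand the square and apply [trace_fenchel]. *)
Lemma objective_lower_bound B W :
  rdot W W - \sum_j penalty_conj tau (sing_val W 0 j) <=
  R_tau tau B + rdot (B - W) (B - W).
Proof.
have := @trace_fenchel R k (fun x => penalty tau x + x ^+ 2)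
  (penalty_conj tau) m n B W (penalty_sqr_ge0 tau_gt0)
  (fun x _ => penalty_conj_ge0 tau_gt0 x) (penalty_fenchel tau_gt0).
by rewrite -R_tau_add_rdot rdot_sub_sub; lra.
Qed.

Lemma R_tau_le_rank B : R_tau tau B <= tau ^+ 2 * (\rank B)%:R.
Proof.
rewrite rank_svd natr_sum mulr_sumr; apply: ler_sum => j _.
exact: penalty_le.
Qed.

End Objective.

Section FixedPoint.
Variables (R : realType) (k : scalars) (M N : nat).
Local Notation K := (scalar_field R k).
Variables (H : {vspace 'M[K]_(M, N)}) (F Wo Ao : 'M[K]_(M, N)) (tau q : R).
Hypotheses (F_in_H : F \in H) (tau_gt0 : 0 < tau) (q_gt1 : 1 < q).
Hypothesis Wo_fixed : B_op H F tau q Wo = Wo.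
Hypothesis Ao_def : Ao = of_real (q - 1)^-1 *:
                     (of_real q *: F - orth_proj [set` H] Wo).

(** Simultaneous singular value decompositions of Wo and Ao. *)
Lemma fixed_point_svd : exists U (z : 'rV[R]_(minn M N)) V,
  [/\ forall j, 0 <= z 0 j,
      is_svd Wo U (map_mx (s_tau_q tau q) z) V,
      is_svd Ao U (map_mx (shrink tau q) z) V,
      Wo = svd_map (s_tau_q tau q) U z V
    & Ao = svd_map (shrink tau q) U z V].
Proof.
have [_ _ perpE] := orth_proj_subspace H Wo.
set Z := of_real q *: F + orth_proj (orthogonal_complement [set` H]) Wo.
have svdZ := sing_val_svd Z.
set U := (svd Z).1.1 in svdZ; set V := (svd Z).2 in svdZ.
set z := sing_val Z in svdZ.
have WE : Wo = svd_map (s_tau_q tau q) U z V by rewrite -Wo_fixed.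
have AE : Ao = svd_map (shrink tau q) U z V.
  have -> : Ao = of_real (q - 1)^-1 *: (Z - Wo).
    by rewrite Ao_def /Z perpE -addrA [Wo - _ - _]addrAC subrr sub0r.
  apply/matrixP => i j; rewrite mxE [(Z - Wo) i j]mxE [(- Wo) i j]mxE.
  rewrite [in Wo i j]WE (svd_map_id svdZ) /svd_map !svd_entry.
  rewrite -sumrB mulr_sumr; apply: eq_bigr => l _; rewrite !mxE.
  rewrite /shrink [in RHS]rmorphM rmorphB /=; ring.
have z0 j : 0 <= z 0 j by exact: sing_val_ge0.
exists U, z, V; split=> //.
- rewrite [X in is_svd X]WE; apply: svd_map_svd svdZ.
    exact: s_tau_q_ge0.
  exact: s_tau_q_nondecreasing.
- rewrite [X in is_svd X]AE; apply: svd_map_svd svdZ.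
    exact: shrink_ge0.
  exact: shrink_nondecreasing.
Qed.

Lemma fixed_point_attains :
  R_tau tau Ao + rdot (Ao - Wo) (Ao - Wo) =
  rdot Wo Wo - \sum_j penalty_conj tau (sing_val Wo 0 j).
Proof.
have [U [z [V [z0 svdW svdA WE AE]]]] := fixed_point_svd.
have [UU VV _ _ _] := svdW.
rewrite rdot_sub_sub addrA addrA R_tau_add_rdot.
have -> : 2 * rdot Ao Wo =
    \sum_j 2 * (shrink tau q (z 0 j) * s_tau_q tau q (z 0 j)).
  by rewrite AE WE rdot_svd_map// mulr_sumr.
rewrite (sing_valE svdA) (sing_valE svdW) addrC; congr (_ + _).
rewrite -sumrB -sumrN; apply: eq_bigr => j _; rewrite !mxE.
by rewrite penalty_fenchel_eq//; ring.
Qed.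

Lemma Ao_in_H : Ao \in H.
Proof.
have [PH _ _] := orth_proj_subspace H Wo.
by rewrite Ao_def memvZ// memvB// memvZ.
Qed.

Lemma rdot_fixed_point B : B \in H ->
  rdot B Wo + (q - 1) * rdot B Ao = q * rdot B F.
Proof.
move=> BH; have [_ perp _] := orth_proj_subspace H Wo.
have q1 : q - 1 != 0 by rewrite subr_eq0 gt_eqF.
have -> : rdot B Wo = rdot B (orth_proj [set` H] Wo).
  apply/eqP; rewrite -subr_eq0 !(rdotC B) -rdotBl; apply/eqP.
  by rewrite /rdot perp// raddf0.
rewrite !(rdotC B) Ao_def rdotZl mulrA mulfV// mul1r rdotBl rdotZl.
by rewrite addrC subrK.
Qed.

(** The last term does not depend on B; see [rdot_fixed_point] for the cross
    terms. *)
Lemma objective_transfer B : B \in H ->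
  q * rdot (B - F) (B - F) =
  rdot (B - Wo) (B - Wo) + (q - 1) * rdot (B - Ao) (B - Ao) +
  (q * rdot F F - rdot Wo Wo - (q - 1) * rdot Ao Ao).
Proof.
move=> /rdot_fixed_point e; rewrite !rdot_sub_sub.
lra.
Qed.

Lemma R_tau_rank : (forall j, sing_val Wo 0 j != tau) ->
  R_tau tau Ao = tau ^+ 2 * (\rank Ao)%:R.
Proof.
have [U [z [V [z0 svdW svdA WE AE]]]] := fixed_point_svd.
rewrite rank_svd /R_tau (sing_valE svdA) (sing_valE svdW) => ntau.
rewrite natr_sum mulr_sumr; apply: eq_bigr => j _.
by have := ntau j; rewrite !mxE => ?; exact: penalty_shrink.
Qed.

(** A quantitative form of unique minimality: replace tau^2 rank(B) by R_tau(B),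
    transfer to the problem around Wo, and use that Ao attains the lower bound
    [objective_lower_bound]. *)
Lemma objective_gap B : (forall j, sing_val Wo 0 j != tau) -> B \in H ->
  tau ^+ 2 * (\rank Ao)%:R + q * rdot (Ao - F) (Ao - F) +
  (q - 1) * rdot (B - Ao) (B - Ao) <=
  tau ^+ 2 * (\rank B)%:R + q * rdot (B - F) (B - F).
Proof.
move=> ntau BH; rewrite -R_tau_rank// !objective_transfer ?Ao_in_H//.
have := R_tau_le_rank tau_gt0 B; have := objective_lower_bound tau_gt0 B Wo.
rewrite -fixed_point_attains subrr.
have -> : rdot (0 : 'M[K]_(M, N)) 0 = 0 by rewrite /rdot inner0l raddf0.
lra.
Qed.

End FixedPoint.

Theorem theorem5p2 (R : realType) (k : scalars) (M N : nat)
    (H : {vspace 'M[scalar_field R k]_(M, N)}) (F : 'M[scalar_field R k]_(M, N))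
    (tau q : R) (W0 Wo Ao : 'M[scalar_field R k]_(M, N))
    (F_in_H : F \in H) (tau_gt0 : 0 < tau) (q_gt1 : 1 < q)
    (Wo_fixed : B_op H F tau q Wo = Wo)
    (Wo_limit :
       (fun n : nat => frobenius (iter n (B_op H F tau q) W0 - Wo)) @ \oo
         --> (0 : R))
    (Ao_def : Ao = of_real (q - 1)^-1 *:
                     (of_real q *: F - orth_proj [set` H] Wo)) :
  [/\ argmin setT (fun A => R_tau tau A + frobenius (A - Wo) ^+ 2) Ao,
      exists U V, is_svd Wo U (sing_val Wo) V /\
        Ao = U *m real_diag (sing_val Ao) *m adjoint V,
      forall U V, is_svd Wo U (sing_val Wo) V ->
        (forall i j, sing_val Wo 0 i = tau -> sing_val Wo 0 j = tau ->
           sing_val Ao 0 i = sing_val Ao 0 j) ->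
        Ao = U *m real_diag (sing_val Ao) *m adjoint V,
      forall j, [/\ tau < sing_val Wo 0 j -> sing_val Ao 0 j = sing_val Wo 0 j,
                    sing_val Wo 0 j = tau ->
                      0 <= sing_val Ao 0 j <= sing_val Wo 0 j
                  & sing_val Wo 0 j < tau -> sing_val Ao 0 j = 0]
    & (forall j, sing_val Wo 0 j != tau) ->
      argmin [set` H]
        (fun A => tau ^+ 2 * (\rank A)%:R + q * frobenius (A - F) ^+ 2)
      = [set Ao]].
Proof.
have [U [z [V [z0 svdW svdA WE AE]]]] :=
  fixed_point_svd tau_gt0 q_gt1 Wo_fixed Ao_def.
have sW := sing_valE svdW; have sA := sing_valE svdA.
have [_ _ _ _ AUV] := svdA.
have trich j : [/\ tau < sing_val Wo 0 j -> sing_val Ao 0 j = sing_val Wo 0 j,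
                   sing_val Wo 0 j = tau ->
                     0 <= sing_val Ao 0 j <= sing_val Wo 0 j
                 & sing_val Wo 0 j < tau -> sing_val Ao 0 j = 0].
  by rewrite sW sA !mxE; exact: shrink_trichotomy.
split=> //.
- split=> // B _; rewrite !frobenius_sq.
  rewrite (fixed_point_attains tau_gt0 q_gt1 Wo_fixed Ao_def).
  exact: objective_lower_bound.
- by exists U, V; rewrite sW sA.
- move=> U' V' svdW' ties.
  (* Off the value tau, the relation between the singular values already
     expresses those of Ao as a function f of those of Wo; the hypothesis on
     ties provides the missing value c = f tau. *)
  pose c : R := if [pick j | sing_val Wo 0 j == tau] is Some j
                then sing_val Ao 0 j else 0.
  pose f (x : R) := if tau < x then x else if x == tau then c else 0.
  have f0 : f 0 = 0 by rewrite /f ltNge ltW//= lt_eqF.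
  have AfW : sing_val Ao = map_mx f (sing_val Wo).
    apply/matrixP => i j; rewrite ord1 [RHS]mxE /f.
    have [gt eq lt] := trich j.
    have [wt|wt|wt] := ltgtP tau (sing_val Wo 0 j); first exact: gt.
      exact: lt.
    rewrite /c; case: pickP => [i' /eqP i't|/(_ j)]; last by rewrite -wt eqxx.
    exact: ties.
  have svdW0 : is_svd Wo U (sing_val Wo) V by rewrite sW.
  have := svd_map_unique svdW0 svdW' f0; rewrite /svd_map -AfW => <-.
  by rewrite sA.
- move=> ntau; rewrite predeqE => B; split=> [[BH Bmin]|->].
    have := Bmin Ao (Ao_in_H F_in_H Ao_def).
    have := objective_gap F_in_H tau_gt0 q_gt1 Wo_fixed Ao_def ntau BH.
    rewrite /= !frobenius_sq => gap Ble.
    have BA : rdot (B - Ao) (B - Ao) <= 0.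
      have q1 : 0 < q - 1 by rewrite subr_gt0.
      by rewrite -(pmulr_rle0 _ q1); lra.
    apply/eqP; rewrite -subr_eq0; apply/eqP/rdot_eq0/le_anti.
    by rewrite BA rdot_ge0.
  have AH := Ao_in_H F_in_H Ao_def.
  split=> // C CH; rewrite !frobenius_sq.
  have := objective_gap F_in_H tau_gt0 q_gt1 Wo_fixed Ao_def ntau CH.
  apply: le_trans; rewrite lerDl mulr_ge0 ?rdot_ge0// subr_ge0 ltW//.
Qed.
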